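(* Let $m \geq 1$ be an integer. Then $\alpha(C(F_{m,1}))=\alpha(C(P_{m}))+1$.
   Context: Graphs are finite and simple. For a graph $G$, the pair graph $C(G)$ (also called complete double vertex graph) is the graph whose vertices are all $2$-multisets of $V(G)$ (so $\{x,x\}$ is allowed), where two vertices $\{x,y\}$ and $\{u,v\}$ are adjacent if and only if $\{x,y\}\cap\{u,v\}=\{a\}$ (multiset intersection) for some $a$ and, writing $x=u=a$, the vertices $y$ and $v$ are adjacent in $G$; that is, the two multisets can be written as $\{a,y\}$ and $\{a,v\}$ with $yv$ an edge of $G$. $P_m$ is the path graph with $m$ vertices ($P_1$ is a single vertex). The fan graph $F_{m,1}$ is the join $P_m+K_1$, where $K_1$ is the complete graph with one vertex (the join of two disjoint graphs adds all edges between them). $\alpha(G)$ denotes the independence number of $G$. *)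

(* Defs.v *)
From HB Require Import structures.
From mathcomp Require Import all_boot.
From mathcomp Require Import finmap multiset.

Set Implicit Arguments.
Unset Strict Implicit.
Unset Printing Implicit Defensive.

Local Open Scope mset_scope.
Local Open Scope nat_scope.

Record sgraph := SGraph {
  svertex :> finType;
  sedge : rel svertex;
  sedge_sym : symmetric sedge;
  sedge_irrefl : irreflexive sedge }.

Definition independent (G : sgraph) (S : {set G}) : bool :=
  [forall x in S, forall y in S, ~~ sedge x y].

Definition indep_number (G : sgraph) : nat :=
  \max_(S : {set G} | independent S) #|S|.

Section Path.
Variable m : nat.

Definition path_edge : rel 'I_m := fun i j => (i.+1 == j) || (j.+1 == i).

Lemma path_edge_sym : symmetric path_edge.
Proof. by move=> i j; rewrite /path_edge orbC. Qed.

Lemma path_edge_irrefl : irreflexive path_edge.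
Proof. by move=> i; rewrite /path_edge orbb gtn_eqF. Qed.

Definition path_graph : sgraph := SGraph path_edge_sym path_edge_irrefl.
End Path.

Section Complete.
Variable n : nat.

Definition complete_edge : rel 'I_n := fun i j => i != j.

Lemma complete_edge_sym : symmetric complete_edge.
Proof. by move=> i j; rewrite /complete_edge eq_sym. Qed.

Lemma complete_edge_irrefl : irreflexive complete_edge.
Proof. by move=> i; rewrite /complete_edge eqxx. Qed.

Definition complete_graph : sgraph :=
  SGraph complete_edge_sym complete_edge_irrefl.
End Complete.

Section Join.
Variables G H : sgraph.

Definition join_edge : rel (G + H)%type := fun u v =>
  match u, v with
  | inl x, inl y => sedge x y
  | inr x, inr y => sedge x y
  | _, _ => true
  end.

Lemma join_edge_sym : symmetric join_edge.
Proof. by move=> [x|x] [y|y] //=; exact: sedge_sym. Qed.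

Lemma join_edge_irrefl : irreflexive join_edge.
Proof. by move=> [x|x] /=; exact: sedge_irrefl. Qed.

Definition join_graph : sgraph := SGraph join_edge_sym join_edge_irrefl.
End Join.

Definition fan_graph (m : nat) : sgraph :=
  join_graph (path_graph m) (complete_graph 1).

Section TwoMultisets.
Variable T : finType.

(* [size A] is the length of the enumeration of [A] with multiplicities. *)
Record mset2 := MSet2 { mset2_val :> {mset T}; _ : size mset2_val == 2 }.

HB.instance Definition _ := [isSub for mset2_val].
HB.instance Definition _ := [Choice of mset2 by <:].

Definition mset2_code (A : mset2) : 2.-tuple T := Tuple (valP A).
Definition mset2_decode (t : 2.-tuple T) : option mset2 :=
  insub (seq_mset t).

Lemma mset2_codeK : pcancel mset2_code mset2_decode.
Proof.
by move=> A; rewrite /mset2_decode /= seq_mset_id; exact: valK.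
Qed.

HB.instance Definition _ := PCanIsCountable mset2_codeK.
HB.instance Definition _ : isFinite mset2 := PCanIsFinite mset2_codeK.
End TwoMultisets.

Section PairGraph.
Variable G : sgraph.

Definition pair_edge : rel (mset2 G) := fun A B =>
  [exists a : G, exists y : G, exists v : G,
    [&& (A : {mset G}) `&` B == [mset a],
        (A : {mset G}) == [mset a; y],
        (B : {mset G}) == [mset a; v] & sedge y v]].

Lemma pair_edge_sym : symmetric pair_edge.
Proof.
suff H A B : pair_edge A B -> pair_edge B A by move=> A B; apply/idP/idP => /H.
case/existsP=> a /existsP [y] /existsP [v] /and4P [AB Aay Bav yv].
apply/existsP; exists a; apply/existsP; exists v; apply/existsP; exists y.
by rewrite msetIC AB Aay Bav sedge_sym.
Qed.

Lemma pair_edge_irrefl : irreflexive pair_edge.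
Proof.
move=> A; apply/negbTE/negP => /existsP [a] /existsP [y] /existsP [v].
case/and4P=> _ /eqP-> /eqP/msetP/(_ v) H.
suff <- : y = v by rewrite sedge_irrefl.
apply/eqP; rewrite eq_sym; move: H.
by rewrite !mset1DE !msetnE eqxx => /addnI; case: (v == y).
Qed.

Definition pair_graph : sgraph := SGraph pair_edge_sym pair_edge_irrefl.
End PairGraph.

(* Main.v *)
(** Let [G] be any graph and [c] the apex of the join [G + K_1].  Adding
    [{c, c}] to an independent set of [C(G)] keeps it independent, which gives
    the lower bound.  Conversely, if [S] is independent in [C(G + K_1)], remove
    [{c, c}] and replace each [{x, c}] in [S] by [{x, x}].  Since [{x, c}] is
    adjacent to every [{x, y}] with [y] in [G], no multiset [{x, y}] of [G]
    lies in [S], so the replacement is injective; and as the neighbours of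
    [{x, x}] in [C(G)] all contain [x], it yields an independent set of
    [C(G)]. *)
Require Import Defs.
From mathcomp Require Import all_boot.
From mathcomp Require Import finmap multiset.

Set Implicit Arguments.
Unset Strict Implicit.
Unset Printing Implicit Defensive.

Local Open Scope mset_scope.
Local Open Scope nat_scope.

Section UnorderedPairs.
Variable T : finType.
Implicit Types (a b c d x y : T) (A : mset2 T).

Lemma seq_mset_pair x y : seq_mset [:: x; y] = [mset x; y].
Proof.
by apply/msetP => z; rewrite mset_seqE mset1DE msetnE /= addn0 ![_ == z]eq_sym.
Qed.

Lemma size_seq_mset_pair x y : size (seq_mset [:: x; y]) == 2.
Proof. by rewrite (perm_size (perm_eq_seq_mset _)). Qed.

(** Going through a list turns equality of pairs into permutation of two-element lists. *)
Definition mpair x y : mset2 T := MSet2 (size_seq_mset_pair x y).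

Lemma mpair_eqE a b c d :
  (mpair a b == mpair c d) =
  ((a == c) && (b == d)) || ((a == d) && (b == c)).
Proof.
rewrite -val_eqE /=; apply/eqP/idP => [/eq_seq_msetP|].
  (* Membership of [a] tells which entry it matches; cancelling that entry leaves a permutation of
     singletons. *)
  move=> P; have := perm_mem P a; rewrite !inE eqxx /= => /esym/orP[] /eqP Ea.
    by move: P; rewrite Ea perm_cons => /perm_small_eq-/(_ isT)[->]; rewrite !eqxx.
  move: P; rewrite Ea perm_sym (perm_catC [:: c] [:: d]) perm_cons.
  by move=> /perm_small_eq-/(_ isT)[->]; rewrite !eqxx orbT.
case/orP=> /andP[/eqP-> /eqP->] //; apply/eq_seq_msetP.
by rewrite (perm_catC [:: d] [:: c]).
Qed.

Lemma mpairC a b : mpair a b = mpair b a.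
Proof. by apply/eqP; rewrite mpair_eqE !eqxx orbT. Qed.

Lemma mset2_eq_mpair A x y : ((A : {mset T}) == [mset x; y]) = (A == mpair x y).
Proof. by rewrite -[A == _]val_eqE /= seq_mset_pair. Qed.

Lemma mpair_code A :
  A = mpair (tnth (mset2_code A) ord0) (tnth (mset2_code A) ord_max).
Proof.
apply: val_inj; rewrite /= -[LHS]seq_mset_id; congr seq_mset.
have -> : mset2_val A = mset2_code A :> seq T by [].
by case/tupleP: (mset2_code A) => x t; case/tupleP: t => y t; rewrite (tuple0 t).
Qed.

Lemma mpairP A : exists x y, A = mpair x y.
Proof. by do 2 eexists; exact: mpair_code. Qed.

End UnorderedPairs.

Section MapPairs.
Variables (T U : finType) (f : T -> U).

Definition mset2_map (A : mset2 T) : mset2 U :=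
  mpair (f (tnth (mset2_code A) ord0)) (f (tnth (mset2_code A) ord_max)).

(** The enumeration behind [mset2_code] may list [x] and [y] in either order; symmetry of [mpair]
    makes both cases agree. *)
Lemma mset2_map_mpair x y : mset2_map (mpair x y) = mpair (f x) (f y).
Proof.
rewrite /mset2_map.
have /eqP := mpair_code (mpair x y).
by rewrite mpair_eqE => /orP[] /andP[/eqP <- /eqP <-] //; rewrite mpairC.
Qed.

Lemma mset2_map_inj : injective f -> injective mset2_map.
Proof.
move=> f_inj A B; have [a [b ->]] := mpairP A; have [c [d ->]] := mpairP B.
move/eqP; rewrite !mset2_map_mpair !mpair_eqE !(inj_eq f_inj) => E.
by apply/eqP; rewrite mpair_eqE.
Qed.

End MapPairs.

Lemma pair_edge_mpair (G : sgraph) (a y v : G) :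
  sedge y v -> pair_edge (mpair a y) (mpair a v).
Proof.
move=> yv; apply/existsP; exists a; apply/existsP; exists y.
apply/existsP; exists v; rewrite !mset2_eq_mpair !eqxx yv /= andbT.
(* The shared [a] comes out of the minimum of multiplicities. What remains is nonzero only if
   [y = v], which irreflexivity excludes. *)
apply/eqP/msetP => x; rewrite !seq_mset_pair !msetE2 -addn_minr !msetnE.
have [->|_] := eqVneq x y; last by rewrite min0n addn0.
have [yE|_] := eqVneq y v; last by rewrite minn0 addn0.
by rewrite yE sedge_irrefl in yv.
Qed.

(** The four cases record which entry of each pair is the shared one, so adjacency becomes a boolean
    computation. *)
Lemma pair_edgeE (G : sgraph) (p q r s : G) :
  pair_edge (mpair p q) (mpair r s) =
  [|| (p == r) && sedge q s, (p == s) && sedge q r,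
      (q == r) && sedge p s | (q == s) && sedge p r].
Proof.
apply/idP/idP.
  case/existsP=> a /existsP[y] /existsP[v] /and4P[_].
  rewrite !mset2_eq_mpair !mpair_eqE.
  by case/orP=> /andP[/eqP-> /eqP->] /orP[] /andP[/eqP-> /eqP->] yv;
    rewrite eqxx yv ?orbT.
case/or4P=> /andP[/eqP<- e]; first exact: pair_edge_mpair.
- by rewrite (mpairC r); exact: pair_edge_mpair.
- by rewrite (mpairC p); exact: pair_edge_mpair.
- by rewrite (mpairC p) (mpairC r); exact: pair_edge_mpair.
Qed.

Lemma independentP (G : sgraph) (S : {set G}) :
  reflect {in S &, forall x y, ~~ sedge x y} (independent S).
Proof.
apply: (iffP forall_inP) => [H x y xS yS|H x xS].
  by move/forall_inP: (H x xS); apply.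
by apply/forall_inP => y; exact: H.
Qed.

Lemma indep_number_ge (G : sgraph) (S : {set G}) :
  independent S -> #|S| <= indep_number G.
Proof. by move=> indS; exact: (@leq_bigmax_cond _ _ (fun S : {set G} => #|S|)). Qed.

Section Cone.
Variable G : sgraph.

Let J := join_graph G (complete_graph 1).
Let apex : J := inr ord0.
Let base (x : G) : J := inl x.
Let lift : pair_graph G -> pair_graph J := mset2_map base.

Lemma cone_vertexP (u : J) : u = apex \/ exists x, u = base x.
Proof. by case: u => [x|i]; [right; exists x | left; rewrite (ord1 i)]. Qed.

Lemma lift_inj : injective lift.
Proof. by apply: mset2_map_inj => x y []. Qed.

Lemma edge_lift A B : sedge (lift A) (lift B) = sedge A B.
Proof.
have [p [q ->]] := mpairP A; have [r [s ->]] := mpairP B.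
by rewrite /lift !mset2_map_mpair /= !pair_edgeE.
Qed.

(** Adjacent pairs share an entry, and [apex] is never a [base] vertex. *)
Lemma edge_lift_apex A : ~~ @sedge (pair_graph J) (mpair apex apex) (lift A).
Proof.
by have [p [q ->]] := mpairP A; rewrite /lift mset2_map_mpair /= pair_edgeE.
Qed.

Lemma indep_number_cone_ge :
  indep_number (pair_graph G) + 1 <= indep_number (pair_graph J).
Proof.
rewrite /indep_number.
(* The maximum is attained because some independent set exists, namely the empty one. *)
have [|S indS ->] := @eq_bigmax_cond _
    (fun S : {set pair_graph G} => independent S) (fun S => #|S|).
  by apply/card_gt0P; exists set0; apply/independentP => x y; rewrite inE.
have apexN : mpair apex apex \notin lift @: S.
  apply/imsetP => -[A _]; have [p [q ->]] := mpairP A.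
  by move/eqP; rewrite /lift mset2_map_mpair mpair_eqE.
have -> : #|S| + 1 = #|mpair apex apex |: lift @: S|.
  by rewrite cardsU1 apexN (card_imset _ lift_inj) addnC.
apply: indep_number_ge; apply/independentP => X Y.
move=> /setU1P[->|/imsetP[A AS ->]] /setU1P[->|/imsetP[B BS ->]].
- by rewrite sedge_irrefl.
- exact: edge_lift_apex.
- by rewrite sedge_sym edge_lift_apex.
- by rewrite edge_lift; exact: (independentP _ indS _ _ AS BS).
Qed.

Section UpperBound.
Variable S : {set pair_graph J}.
Hypothesis indS : independent S.

Let fold : {set pair_graph G} :=
  [set A | (lift A \in S) ||
    [exists x, (A == mpair x x) && (mpair (base x) apex \in S)]].

(** Undoes the replacement. An element of [fold] whose lift is outside [S] is some [mpair x x], so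
    taking the first entry recovers [x]. *)
Let unfold (A : pair_graph G) : pair_graph J :=
  if lift A \in S then lift A
  else mpair (base (tnth (mset2_code A) ord0)) apex.

(** If [x] were [p] or [q], the two pairs would share [base x], and their other entries would be
    joined by a cone edge at [apex]. *)
Lemma edge_spoke (x p q : G) : mpair (base x) apex \in S ->
  lift (mpair p q) \in S -> (x != p) && (x != q).
Proof.
move=> xS pqS; have := independentP _ indS _ _ xS pqS.
by rewrite /lift mset2_map_mpair /= pair_edgeE /= !andbT !orbF negb_or.
Qed.

Lemma diag_not_adj (x : G) B : mpair (base x) apex \in S -> lift B \in S ->
  ~~ @sedge (pair_graph G) (mpair x x) B.
Proof.
have [p [q ->]] := mpairP B => xS /(edge_spoke xS) /andP[/negPf xp /negPf xq].
by rewrite /= pair_edgeE xp xq.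
Qed.

Lemma independent_fold : independent fold.
Proof.
apply/independentP => A B; rewrite !inE.
case/orP=> [AS|/existsP[x /andP[/eqP-> xS]]];
  case/orP=> [BS|/existsP[y /andP[/eqP-> yS]]].
- by rewrite -edge_lift; exact: (independentP _ indS _ _ AS BS).
- by rewrite sedge_sym diag_not_adj.
- exact: diag_not_adj.
(* Two diagonal pairs share an entry only if they coincide, and an edge would then be a loop. *)
- by rewrite /= pair_edgeE; case: eqP => //= ->; rewrite sedge_irrefl.
Qed.

(** Injectivity of the replacement enters in this form: [unfold] maps [fold] onto at least all of
    [S] except the double apex, which suffices to compare cardinalities. *)
Lemma sub_unfold : S :\ mpair apex apex \subset unfold @: fold.
Proof.
have spoke x : mpair (base x) apex \in S -> mpair (base x) apex \in unfold @: fold.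
  move=> xS; apply/imsetP; exists (mpair x x).
    by rewrite inE; apply/orP; right; apply/existsP; exists x; rewrite eqxx xS.
  (* The lift of [mpair x x] cannot lie in [S], since [edge_spoke] would give [x != x]. *)
  rewrite /unfold; case: ifPn => [/(edge_spoke xS)|_]; first by rewrite eqxx.
  have /eqP := mpair_code (mpair x x).
  by rewrite mpair_eqE => /orP[] /andP[/eqP E0 /eqP E1]; rewrite -?E0 -?E1.
apply/subsetP => A; have [u [v ->]] := mpairP A; rewrite !inE => /andP[].
case: (cone_vertexP u) => [->|[x ->]]; case: (cone_vertexP v) => [->|[y ->]].
- by rewrite eqxx.
- by move=> _; rewrite mpairC; exact: spoke.
- by move=> _; exact: spoke.
- move=> _ xyS; have liftE : lift (mpair x y) = mpair (base x) (base y).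
    exact: mset2_map_mpair.
  apply/imsetP; exists (mpair x y); first by rewrite inE liftE xyS.
  by rewrite /unfold liftE xyS.
Qed.

Lemma card_independent_cone : #|S| <= indep_number (pair_graph G) + 1.
Proof.
(* The summand 1 pays for the double apex, which may or may not belong to [S]. *)
rewrite (cardsD1 (mpair apex apex)) addnC leq_add ?leq_b1 //.
apply: leq_trans (subset_leq_card sub_unfold) _.
exact: leq_trans (leq_imset_card _ _) (indep_number_ge independent_fold).
Qed.

End UpperBound.

Lemma indep_number_cone :
  indep_number (pair_graph J) = indep_number (pair_graph G) + 1.
Proof.
apply/eqP; rewrite eqn_leq indep_number_cone_ge andbT.
by apply/bigmax_leqP => S; exact: card_independent_cone.
Qed.

End Cone.

Theorem theorem1p4 (m : nat) (hm : 1 <= m) :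
  indep_number (pair_graph (fan_graph m)) =
  indep_number (pair_graph (path_graph m)) + 1.
Proof. exact: indep_number_cone. Qed.
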